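(* For any $m,q,n\in\mathbb{N}$ with $n\ge q+m-1$, any integer $p\in[0,m]$, and any sequences of complex numbers $a_{(1);N},\ldots,a_{(m);N}$ defined for integers $N$ in $[q,n+1]$, $$P_{m,q,n+1}=\sum_{k=p+1}^{m}\left(\prod_{j=0}^{m-k-1}a_{(m-j);\,n+1-j}\right)P_{k,q,n-m+k}+\left(\prod_{j=0}^{m-p-1}a_{(m-j);\,n+1-j}\right)P_{p,q,n-m+p+1}.$$
   Context: $\mathbb{N}=\{0,1,2,\ldots\}$. Empty sums equal $0$ and empty products equal $1$. For given sequences, $P_{k,q,M}=\sum_{q\le N_1<\cdots<N_k\le M}a_{(k);N_k}\cdots a_{(2);N_2}a_{(1);N_1}$ is the multiple sum of order $k$ over all strictly increasing $k$-tuples of integers in $[q,M]$. It uses the first $k$ sequences. For $k=0$ it equals $1$ whatever its bounds; for $k\ge1$ it equals $0$ when there are no such tuples. *)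

(* Defs.v *)
From mathcomp Require Import all_boot all_order all_algebra complex.
From mathcomp Require Import reals.

Set Implicit Arguments.
Unset Strict Implicit.
Unset Printing Implicit Defensive.

Import GRing.Theory.

Local Open Scope ring_scope.

(* [a i N] is a_{(i);N}, with i counted from 1; N_1, ..., N_k are stored as the
   values N 0, ..., N (k-1), hence the shift [i.+1]. *)
Definition multisum (R : realType) (a : nat -> nat -> R[i]) (k q M : nat)
    : R[i] :=
  \sum_(N : {ffun 'I_k -> 'I_M.+1}
        | [forall i : 'I_k, q <= N i]%N
          && [forall i : 'I_k, forall j : 'I_k, (i < j) ==> (N i < N j)]%N)
     \prod_(i < k) a i.+1 (N i).

(* Main.v *)
Require Import Defs.
From mathcomp Require Import all_boot all_order all_algebra complex.
From mathcomp Require Import reals.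
From mathcomp Require Import zify.

Import GRing.Theory.

Local Open Scope ring_scope.

(** The whole identity is an unrolling of one recurrence: an increasing tuple
    of length [k + 1] in [[q, M + 1]] either has largest entry [M + 1], and then
    its first [k] entries form an arbitrary increasing tuple in [[q, M]], or it
    lies entirely in [[q, M]].  Hence ([multisum_rec])
      [P_(k+1, q, M+1) = a_(k+1; M+1) P_(k, q, M) + P_(k+1, q, M)].
    Start from [p = m], where the right-hand side is [P_(m, q, n+1)] itself, and
    let [p] decrease.  Applying the recurrence to the last term, of order
    [p + 1] and upper bound [n - m + p + 2], splits it into the summand of index
    [k = p + 1] and the last term for [p], with one more factor
    [a_(p+1; n-m+p+2)] in the product.  The assumption on [n] keeps every upper
    bound met on the way at least [q], which is what allows the largest entry
    to be equal to that bound. *)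

(** * Increasing tuples and their largest entry *)

Definition increasing_from (q : nat) {k M : nat}
    (N : {ffun 'I_k -> 'I_M.+1}) : bool :=
  [forall i : 'I_k, q <= N i]%N
  && [forall i : 'I_k, forall j : 'I_k, (i < j) ==> (N i < N j)]%N.

Lemma increasing_fromP (q k M : nat) (N : {ffun 'I_k -> 'I_M.+1}) :
  reflect ((forall i : 'I_k, q <= N i)%N
           /\ (forall i j : 'I_k, i < j -> N i < N j)%N)
          (increasing_from q N).
Proof.
apply: (iffP andP) => -[qN incN]; split.
- exact/forallP.
- by move=> i j; apply/implyP; move/forallP/(_ i)/forallP: incN; apply.
- exact/forallP.
- by apply/forallP=> i; apply/forallP=> j; apply/implyP/incN.
Qed.

Definition extend_max {k M : nat} (N : {ffun 'I_k -> 'I_M.+1}) :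
    {ffun 'I_k.+1 -> 'I_M.+2} :=
  [ffun i => if unlift ord_max i is Some j then widen_ord (leqnSn M.+1) (N j)
             else ord_max].

Definition widen_tuple {k M : nat} (N : {ffun 'I_k -> 'I_M.+1}) :
    {ffun 'I_k -> 'I_M.+2} :=
  [ffun i => widen_ord (leqnSn M.+1) (N i)].

(** A left inverse of [widen_tuple]; an entry [M.+1] has no preimage and is
    sent to the default value of [inord]. *)
Definition narrow_tuple {k M : nat} (N : {ffun 'I_k -> 'I_M.+2}) :
    {ffun 'I_k -> 'I_M.+1} :=
  [ffun i => inord (N i)].

Definition drop_max {k M : nat} (N : {ffun 'I_k.+1 -> 'I_M.+2}) :
    {ffun 'I_k -> 'I_M.+1} :=
  [ffun i => inord (N (lift ord_max i))].

Lemma extend_max_lift (k M : nat) (N : {ffun 'I_k -> 'I_M.+1}) (j : 'I_k) :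
  extend_max N (lift ord_max j) = widen_ord (leqnSn M.+1) (N j).
Proof. by rewrite ffunE liftK. Qed.

Lemma extend_max_last (k M : nat) (N : {ffun 'I_k -> 'I_M.+1}) :
  extend_max N ord_max = ord_max.
Proof. by rewrite ffunE unlift_none. Qed.

Lemma extend_maxK (k M : nat) : cancel (@extend_max k M) drop_max.
Proof.
move=> N; apply/ffunP=> j; apply: val_inj.
by rewrite ffunE extend_max_lift /= inordK.
Qed.

Lemma widen_tupleK (k M : nat) : cancel (@widen_tuple k M) narrow_tuple.
Proof. by move=> N; apply/ffunP=> i; apply: val_inj; rewrite !ffunE /= inordK. Qed.

(** All entries before the last are below [M.+1], being smaller than the last
    one, so that no information is lost when they are narrowed. *)
Lemma drop_maxK (q k M : nat) (N : {ffun 'I_k.+1 -> 'I_M.+2}) :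
  increasing_from q N -> N ord_max = ord_max -> extend_max (drop_max N) = N.
Proof.
case/increasing_fromP=> _ incN Nmax; apply/ffunP=> i; apply: val_inj.
case: (unliftP ord_max i) => [j|] ->; last by rewrite extend_max_last Nmax.
rewrite extend_max_lift ffunE /= inordK //.
have /incN : (lift ord_max j < @ord_max k)%N by rewrite lift_max ltn_ord.
by rewrite Nmax.
Qed.

Lemma narrow_tupleK (q k M : nat) (N : {ffun 'I_k.+1 -> 'I_M.+2}) :
  increasing_from q N -> N ord_max != ord_max ->
  widen_tuple (narrow_tuple N) = N.
Proof.
case/increasing_fromP=> _ incN Nmax; apply/ffunP=> i; apply: val_inj.
have ltN : (N ord_max < M.+1)%N.
  by rewrite ltn_neqAle -ltnS ltn_ord andbT.
rewrite !ffunE /= inordK //.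
case: (unliftP ord_max i) => [j|] -> //; apply: ltn_trans ltN.
by apply: incN; rewrite lift_max ltn_ord.
Qed.

(** The bound on [q] is what the new last entry [M.+1] has to satisfy. *)
Lemma increasing_from_extend_max (q k M : nat) (N : {ffun 'I_k -> 'I_M.+1}) :
  (q <= M.+1)%N -> increasing_from q (extend_max N) = increasing_from q N.
Proof.
move=> qM; apply/increasing_fromP/increasing_fromP=> -[qN incN]; split.
- by move=> i; have := qN (lift ord_max i); rewrite extend_max_lift.
- move=> i j ij; have := incN (lift ord_max i) (lift ord_max j).
  by rewrite !extend_max_lift !lift_max; apply.
- move=> i; case: (unliftP ord_max i) => [j|] ->.
    by rewrite extend_max_lift; apply: qN.
  by rewrite extend_max_last.
- move=> i j.
  case: (unliftP ord_max i) => [i'|] ->; case: (unliftP ord_max j) => [j'|] ->.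
  + by rewrite !extend_max_lift !lift_max; apply: incN.
  + by rewrite extend_max_lift extend_max_last /= => _; apply: ltn_ord.
  + by rewrite lift_max /= => /ltn_trans/(_ (ltn_ord j')); rewrite ltnn.
  + by rewrite ltnn.
Qed.

Lemma increasing_from_widen_tuple (q k M : nat) (N : {ffun 'I_k -> 'I_M.+1}) :
  increasing_from q (widen_tuple N) = increasing_from q N.
Proof.
apply/increasing_fromP/increasing_fromP=> -[qN incN]; split.
- by move=> i; have := qN i; rewrite ffunE.
- by move=> i j /incN; rewrite !ffunE.
- by move=> i; rewrite ffunE; apply: qN.
- by move=> i j /incN; rewrite !ffunE.
Qed.

(** * The recurrence and its iteration *)

(** The tuples are split according to whether their last, hence largest, entry
    is [M.+1]; [extend_max] and [widen_tuple] parametrize the two classes. *)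
Lemma multisum_rec (R : realType) (a : nat -> nat -> R[i]) (k q M : nat) :
  (q <= M.+1)%N ->
  multisum a k.+1 q M.+1 = a k.+1 M.+1 * multisum a k q M + multisum a k.+1 q M.
Proof.
move=> qM.
rewrite {1}/multisum (bigID (fun N : {ffun _ -> _} => N ord_max == ord_max)) /=.
congr (_ + _).
- rewrite (reindex_onto extend_max drop_max); last first.
    by move=> N /andP[incN /eqP]; apply: drop_maxK incN.
  rewrite mulr_sumr; apply: eq_big => [N|N _].
    rewrite extend_maxK extend_max_last !eqxx !andbT.
    exact: increasing_from_extend_max.
  rewrite big_ord_recr /= extend_max_last mulrC; congr (_ * _).
  apply: eq_bigr => i _.
  suff -> : widen_ord (leqnSn k) i = lift ord_max i by rewrite extend_max_lift.
  by apply: val_inj; exact: esym (lift_max i).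
- rewrite (reindex_onto widen_tuple narrow_tuple); last first.
    by move=> N /andP[incN]; apply: narrow_tupleK incN.
  apply: eq_big => [N|N _].
    rewrite widen_tupleK eqxx andbT ffunE.
    (* a widened entry is at most [M], so it is never [M.+1] *)
    rewrite -val_eqE /= neq_ltn ltn_ord andbT.
    exact: increasing_from_widen_tuple.
  by apply: eq_bigr => i _; rewrite ffunE.
Qed.

Theorem theorem2p3 (R : realType) (m q n p : nat) (a : nat -> nat -> R[i])
    (hn : (q + m <= n + 1)%N) (hp : (p <= m)%N) :
  multisum a m q (n + 1) =
    \sum_(p + 1 <= k < m + 1)
       (\prod_(0 <= j < m - k) a (m - j)%N (n + 1 - j)%N)
         * multisum a k q (n + k - m)
    + (\prod_(0 <= j < m - p) a (m - j)%N (n + 1 - j)%N)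
        * multisum a p q (n + p + 1 - m).
Proof.
(* descending induction on [p], as an induction on [d = m - p] *)
move: {2}(m - p)%N (erefl (m - p)%N) => d.
elim: d p hp => [|d IHd] p hp mp.
  have -> : p = m by lia.
  rewrite subnn !big_geq // mul1r add0r.
  by congr (multisum a m q _); lia.
rewrite (IHd p.+1); [|lia..].
rewrite (big_ltn (m := p + 1)); last lia.
have -> : (n + p.+1 + 1 - m = (n + p + 1 - m).+1)%N by lia.
rewrite multisum_rec; last lia.
have -> : (m - p = (m - p.+1).+1)%N by lia.
rewrite big_nat_recr //=.
(* the factor split off by the recurrence is the one of index [j = m - p - 1] *)
have -> : (m - (m - p.+1) = p.+1)%N by lia.
have -> : (n + 1 - (m - p.+1) = (n + p + 1 - m).+1)%N by lia.
have -> : (n + (p + 1) - m = n + p + 1 - m)%N by lia.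
by rewrite !addn1 mulrDr mulrA addrCA addrC; congr (_ + _); rewrite addrC.
Qed.
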